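(* Let $\mathcal{H}$ be a Hilbert space, $S\subset\mathcal{H}$ a nonempty closed set, $x\in\mathcal{H}$, and $\varepsilon>0$. For each $z\in\operatorname{proj}_S^{\varepsilon}(x)$ there is $v\in\operatorname{proj}_S^{\varepsilon}(x)$ such that $\|z-v\|<2\sqrt{\varepsilon}$ and $$x-z\in\big(4\sqrt{\varepsilon}+d_S(x)\big)\,\partial_Pd_S(v)+3\sqrt{\varepsilon}\,\mathbb{B}.$$
   Context: $\mathbb{B}$ is the closed unit ball of $\mathcal{H}$; $d_S(x)=\inf_{z\in S}\|x-z\|$; $\operatorname{proj}_S^\varepsilon(x)=\{z\in S:\|x-z\|^2<d_S^2(x)+\varepsilon\}$. For a lower semicontinuous $f\colon\mathcal{H}\to\mathbb{R}\cup\{+\infty\}$ and $x\in\operatorname{dom}f$, the proximal subdifferential $\partial_Pf(x)$ is the set of $\zeta\in\mathcal{H}$ for which there are $\sigma\ge0$ and $\eta>0$ such that $f(y)\ge f(x)+\langle\zeta,y-x\rangle-\sigma\|y-x\|^2$ for all $y$ with $\|y-x\|<\eta$. *)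

(* Defs.v *)
From HB Require Import structures.
From mathcomp Require Export all_boot all_order all_algebra.
From mathcomp Require Export all_classical all_reals all_analysis.

Set Implicit Arguments.
Unset Strict Implicit.
Unset Printing Implicit Defensive.

Import Order.TTheory GRing.Theory Num.Theory.
Import numFieldNormedType.Exports.

Local Open Scope classical_set_scope.
Local Open Scope ring_scope.

Section Distance.
Context {R : realType} {H : normedModType R}.

(* For [S = set0] this is the junk value [0] of [inf]; nonemptiness of [S] is
   always assumed where [dist] is used. *)
Definition dist (S : set H) (x : H) : R := inf [set `|x - z| | z in S].

Definition eps_proj (S : set H) (eps : R) (x : H) : set H :=
  [set z | S z /\ `|x - z| ^+ 2 < dist S x ^+ 2 + eps].

End Distance.

Section ProximalSubdifferential.
Context {R : realType} {H : normedModType R}.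

(* [f x \is a fin_num] expresses [x \in dom f] for functions valued in
   R u {+oo}; the set is empty at points outside the domain. *)
Definition prox_subdiff (ip : {dot H for idfun}) (f : H -> \bar R) (x : H)
    : set H :=
  [set zeta | f x \is a fin_num /\
     exists sigma eta : R, [/\ 0 <= sigma, 0 < eta &
       forall y, `|y - x| < eta ->
         (f x + (ip zeta (y - x) - sigma * `|y - x| ^+ 2)%:E <= f y)%E]].

End ProximalSubdifferential.

(* Main.v *)
(* Moving a point p a fraction t of the way towards an almost nearest point of
   S forces all almost nearest points of the new position to be close to the
   old one; iterating with summable steps shows that the points admitting a
   nearest point in S are dense (Lau's theorem).  Apply this to the midpoint of
   x and z: a nearby p has a nearest point v in S, which by the parallelogram
   law is an almost nearest point of x close to z.  The proximal normal
   2 (p - v) is x - z up to 2 (z - v) and a small error, and a proximal normal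
   scaled into the unit ball is a proximal subgradient of the distance. *)
Require Import Defs.
From HB Require Import structures.
From mathcomp Require Import all_boot all_order all_algebra.
From mathcomp Require Import all_classical all_reals all_analysis.
From mathcomp Require Import ring lra.

Set Implicit Arguments.
Unset Strict Implicit.
Unset Printing Implicit Defensive.

Import Order.TTheory GRing.Theory Num.Theory.
Import numFieldNormedType.Exports.

Local Open Scope classical_set_scope.
Local Open Scope ring_scope.

Section InnerProduct.
Context {R : realType} {H : normedModType R} (ip : {dot H for idfun}).
Hypothesis ip_norm : forall u : H, `|u| ^+ 2 = ip u u.

Lemma ipC (u v : H) : ip u v = ip v u.
Proof. by rewrite (hermC ip) expr0 mul1r. Qed.

Lemma ipDl (u v w : H) : ip (u + v) w = ip u w + ip v w.
Proof. exact: linearDl. Qed.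

Lemma ipNl (u v : H) : ip (- u) v = - ip u v.
Proof. exact: linearNl. Qed.

Lemma ipZl (c : R) (u v : H) : ip (c *: u) v = c * ip u v.
Proof. exact: linearZl_LR. Qed.

Lemma ipDr (u v w : H) : ip u (v + w) = ip u v + ip u w.
Proof. exact: linearDr. Qed.

Lemma ipNr (u v : H) : ip u (- v) = - ip u v.
Proof. exact: linearNr. Qed.

Lemma ipZr (c : R) (u v : H) : ip u (c *: v) = c * ip u v.
Proof. by rewrite ipC ipZl ipC. Qed.

Definition ipE := (ipDl, ipDr, ipNl, ipNr, ipZl, ipZr).

(** Cauchy-Schwarz is read off from the triangle inequality of the given norm by expanding both
    squares. *)
Lemma ler_ip (u v : H) : ip u v <= `|u| * `|v|.
Proof.
have : `|u + v| ^+ 2 <= (`|u| + `|v|) ^+ 2.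
  by rewrite ler_sqr ?nnegrE ?addr_ge0 ?normr_ge0 // ler_normD.
rewrite sqrrD !ip_norm !ipE (ipC v u); lra.
Qed.

Lemma sqr_norm_segment (t : R) (a b : H) :
  `|(1 - t) *: a + t *: b| ^+ 2 =
  (1 - t) * `|a| ^+ 2 + t * `|b| ^+ 2 - t * (1 - t) * `|a - b| ^+ 2.
Proof. by rewrite !ip_norm !ipE (ipC b a); ring. Qed.

Lemma sqr_normB (a b : H) : `|a - b| ^+ 2 = `|a| ^+ 2 - 2 * ip a b + `|b| ^+ 2.
Proof. by rewrite !ip_norm !ipE (ipC b a); ring. Qed.

End InnerProduct.

Section Distance.
Context {R : realType} {H : normedModType R} (S : set H).

Lemma dist_le x s : S s -> dist S x <= `|x - s|.
Proof. by move=> Ss; apply: ge_inf; [exists 0 => _ [z _ <-] | exists s]. Qed.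

Lemma dist_ge x c :
  S !=set0 -> (forall s, S s -> c <= `|x - s|) -> c <= dist S x.
Proof.
by move=> [s Ss] Sc; apply: lb_le_inf => [|_ [z Sz <-]]; [exists `|x - s|, s | exact: Sc].
Qed.

Lemma dist_mem v : S v -> dist S v = 0.
Proof.
move=> Sv; apply/eqP; rewrite eq_le dist_ge ?andbT //; last by exists v.
by rewrite (le_trans (dist_le _ Sv)) // subrr normr0.
Qed.

(** The error is added to the squared distance, the form in which [sqr_norm_segment] can absorb
    it. *)
Lemma near_proj_exists x eta : S !=set0 -> 0 < eta ->
  exists2 s, S s & forall y, S y -> `|x - s| ^+ 2 <= `|x - y| ^+ 2 + eta.
Proof.
move=> [s0 Ss0] eta0; pose E := [set `|x - z| ^+ 2 | z in S].
have lbE : has_lbound E by exists 0 => _ [z _ <-]; rewrite exprn_ge0.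
have [|_ [s Ss <-] /ltW hs] := inf_adherent eta0 (E := E).
  by split=> //; exists (`|x - s0| ^+ 2), s0.
exists s => // y Sy; apply: (le_trans hs); rewrite lerD2r.
by apply: ge_inf => //; exists y.
Qed.

End Distance.

Lemma cvg_geometric_steps (R : realType) (V : completeNormedModType R)
    (u : nat -> V) (C : R) :
  (forall n, `|u n.+1 - u n| <= C / 2 ^+ n) ->
  exists l, u @ \oo --> l /\ `|l - u 0%N| <= 2 * C.
Proof.
move=> hu.
have cu : cvgn u.
  have -> : u = (fun n => u 0%N + series (telescope u) n).
    by apply/funext => n; rewrite -eq_sum_telescope.
  apply: is_cvgD; first exact: is_cvg_cst.
  apply: normed_cvg; apply: (@series_le_cvg _ _ (geometric C 2^-1)).
  - by move=> n; rewrite normr_ge0.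
  - by move=> n; rewrite /= exprVn; apply: le_trans (hu n).
  - by move=> n; rewrite /= exprVn; apply: hu.
  - by apply: is_cvg_geometric_series; rewrite ger0_norm; lra.
exists (limn u); split=> //.
(* The right-hand side is the exact partial sum of the geometric majorant, so the induction
   closes. *)
have bound n : `|u n - u 0%N| <= 2 * C - 2 * C / 2 ^+ n.
  elim: n => [|n IHn]; first by rewrite subrr normr0 expr0 divr1 subrr.
  have -> : u n.+1 - u 0%N = (u n.+1 - u n) + (u n - u 0%N) by rewrite addrA subrK.
  apply: le_trans (ler_normD _ _) _; apply: le_trans (lerD (hu n) IHn) _.
  by rewrite exprS invfM; lra.
have C0 : 0 <= C by have := hu 0%N; rewrite expr0 divr1; apply: le_trans.
have cl : `|u n - u 0%N| @[n --> \oo] --> `|limn u - u 0%N|.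
  by apply: cvg_norm; apply: cvgB => //; apply: cvg_cst.
rewrite -(cvg_lim _ cl) //; apply: limr_le; first by apply/cvg_ex; eexists; exact: cl.
apply: nearW => n; apply: le_trans (bound n) _.
by rewrite gerBl divr_ge0 ?mulr_ge0 ?exprn_ge0.
Qed.

Section NearestPoints.
Context {R : realType} {H : completeNormedModType R} (ip : {dot H for idfun}).
Hypothesis ip_norm : forall u : H, `|u| ^+ 2 = ip u u.
Variable S : set H.
Hypothesis S_neq0 : S !=set0.

Definition nearest (p v : H) := S v /\ forall y, S y -> `|p - v| <= `|p - y|.

(** By [sqr_norm_segment], the squared distance from the moved point to [y] contains the penalty
    [t * |s - y|^2], which vanishes at [s]; at [s'] only the two errors can pay for it. *)
Lemma near_proj_step (p s s' : H) (t eta eta' : R) :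
  S s' -> 0 < t <= 1 -> 0 <= eta ->
  (forall y, S y -> `|p - s| ^+ 2 <= `|p - y| ^+ 2 + eta) ->
  `|p + t *: (s - p) - s'| ^+ 2 <= `|p + t *: (s - p) - s| ^+ 2 + eta' ->
  t * `|s - s'| ^+ 2 <= eta + eta'.
Proof.
move=> Ss' /andP[t0 t1] eta0 /(_ _ Ss') hs.
have E y : `|p + t *: (s - p) - y| ^+ 2 =
    (1 - t) * `|p - y| ^+ 2 + t * `|s - y| ^+ 2 - t * (1 - t) * `|p - s| ^+ 2.
  have -> : p + t *: (s - p) - y = (1 - t) *: (p - y) + t *: (s - y).
    rewrite scalerBl scale1r -[RHS]addrA [- _ + _]addrC -scalerBr addrAC.
    by rewrite opprB addrA subrK.
  by rewrite (sqr_norm_segment ip_norm) opprB addrA subrK.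
rewrite !E subrr normr0.
have := mulr_ge0 (ltW t0) eta0.
have : 0 <= (1 - t) * (`|p - s'| ^+ 2 + eta - `|p - s| ^+ 2).
  by rewrite mulr_ge0 ?subr_ge0.
nra.
Qed.

Lemma nearest_dense (p0 : H) (e : R) : closed S -> 0 < e ->
  exists p v, nearest p v /\ `|p - p0| <= e.
Proof.
move=> S_closed e0; have [y0 Sy0] := S_neq0.
(* [B] will bound every [|p n - s n|^2]; the summand 2 leaves room for the errors and gives
   [|p n - s n| <= B] as well. The cap on [tau] keeps the total displacement below [e]. *)
pose B := `|p0 - y0| ^+ 2 + 2.
have B2 : 2 <= B by rewrite lerDr exprn_ge0.
pose tau := Num.min 1 (e / (2 * B)).
have tau0 : 0 < tau by rewrite lt_min ltr01 divr_gt0 // mulr_gt0 //; lra.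
have tau1 : tau <= 1 by rewrite ge_min lexx.
have tauB : 2 * (tau * B) <= e.
  have : tau <= e / (2 * B) by rewrite ge_min lexx orbT.
  by rewrite ler_pdivlMr; lra.
(* The ratio [eta n / t n] is [4^-n], so [near_proj_step] makes the steps of [s] of order [2^-n],
   hence summable. *)
pose eta n : R := tau / 8 ^+ n; pose t n : R := tau / 2 ^+ n.
have eta0 n : 0 < eta n by rewrite divr_gt0 ?exprn_gt0.
have eta8 n : eta n = 8 * eta n.+1 by rewrite /eta exprS; field; rewrite expf_neq0.
(* For a nonpositive tolerance [g] may return anything, here 0; it is applied only at
   [eta n > 0]. *)
have /choice[g hg] (x : R * H) : exists s, 0 < x.1 -> S s /\
    forall y, S y -> `|x.2 - s| ^+ 2 <= `|x.2 - y| ^+ 2 + x.1.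
  case: x => a q /=; have [a0|a0] := ltP 0 a; last by exists 0 => //; rewrite ltNge a0.
  by have [s Ss hs] := near_proj_exists q S_neq0 a0; exists s.
pose p := fix p n :=
  if n is m.+1 then p m + t m *: (g (eta m, p m) - p m) else p0.
pose s n := g (eta n, p n).
have pS n : p n.+1 = p n + t n *: (s n - p n) by [].
have Ss n : S (s n) by have [] := hg (eta n, p n) (eta0 n).
have near_s n y : S y -> `|p n - s n| ^+ 2 <= `|p n - y| ^+ 2 + eta n.
  by have [_] := hg (eta n, p n) (eta0 n); apply.
have t01 n : 0 < t n <= 1.
  rewrite divr_gt0 ?exprn_gt0 //= ler_pdivrMr ?exprn_gt0 // mul1r.
  by rewrite (le_trans tau1) // exprn_ege1 //; lra.
(* Moving towards [s n] does not increase the distance to it, and the slack [eta n] pays for the new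
   error since [2 * eta n.+1 <= eta n]. *)
have bound n : `|p n - s n| ^+ 2 <= B - eta n.
  elim: n => [|n IHn].
    apply: le_trans (near_s 0%N _ Sy0) _.
    rewrite /B /eta expr0 divr1; lra.
  apply: le_trans (near_s n.+1 _ (Ss n)) _.
  have -> : p n.+1 - s n = (1 - t n) *: (p n - s n).
    by rewrite pS scalerBl scale1r addrAC -[s n - p n]opprB scalerN.
  have h : `|(1 - t n) *: (p n - s n)| ^+ 2 <= `|p n - s n| ^+ 2.
    have /andP[tn0 tn1] := t01 n.
    rewrite ler_sqr ?nnegrE ?normr_ge0 // normrZ ler_piMl // ger0_norm; lra.
  have := eta8 n; have := eta0 n.+1; lra.
have step_p n : `|p n.+1 - p n| <= tau * B / 2 ^+ n.
  have /andP[tn0 _] := t01 n.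
  rewrite pS addrC addKr normrZ gtr0_norm // [leRHS]mulrAC -/(t n) distrC ler_pM2l //.
  have := bound n; have := eta0 n; have := normr_ge0 (p n - s n); nra.
have step_s n : `|s n.+1 - s n| <= 2 / 2 ^+ n.
  have h : t n * `|s n - s n.+1| ^+ 2 <= eta n + eta n.+1.
    apply: near_proj_step (Ss n.+1) (t01 n) (ltW (eta0 n)) (near_s n) _.
    by rewrite -pS; apply: near_s.
  rewrite distrC -ler_sqr ?nnegrE ?divr_ge0 ?exprn_ge0 //.
  have /andP[tn0 _] := t01 n; rewrite -(ler_pM2l tn0) (le_trans h) //.
  have -> : t n * (2 / 2 ^+ n) ^+ 2 = 4 * eta n.
    rewrite /t /eta (_ : 8 ^+ n = (2 ^+ n) ^+ 3 :> R); first by field; rewrite expf_neq0.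
    by rewrite exprAC; congr (_ ^+ n); ring.
  have := eta8 n; have := eta0 n.+1; lra.
have [q [cp hq]] := cvg_geometric_steps step_p.
have [v [cs _]] := cvg_geometric_steps step_s.
exists q, v; split; last by apply: le_trans hq tauB.
split; first by apply: closed_cvg cs => //; apply: nearW.
move=> y Sy; rewrite -ler_sqr ?nnegrE ?normr_ge0 // -[leRHS]addr0.
have ceta : eta n @[n --> \oo] --> (0 : R).
  have -> : eta = geometric tau 8^-1 by apply/funext => n; rewrite /= exprVn.
  by apply: cvg_geometric; rewrite ger0_norm; lra.
have c1 : `|p n - s n| ^+ 2 @[n --> \oo] --> `|q - v| ^+ 2.
  by rewrite expr2; apply: cvgM; apply: cvg_norm; apply: cvgB.
have c2 : `|p n - y| ^+ 2 + eta n @[n --> \oo] --> `|q - y| ^+ 2 + 0.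
  apply: cvgD => //; rewrite expr2.
  by apply: cvgM; apply: cvg_norm; apply: cvgB => //; apply: cvg_cst.
by apply: ler_cvg_to c1 c2 _; apply: nearW => n; apply: near_s.
Qed.

Lemma nearest_prox_subdiff (p v : H) (t : R) : nearest p v -> 0 <= t ->
  `|t *: (p - v)| <= 1 ->
  prox_subdiff ip (fun y => (dist S y)%:E) v (t *: (p - v)).
Proof.
(* The inequality holds for all [y], so the radius 1 is arbitrary; [2 * t] is [t / 2], from [h],
   times the square of the factor 2 in [h2]. *)
move=> [Sv pv] t0 xi1; split=> //=; exists (2 * t), 1; split=> //.
  by rewrite mulr_ge0.
move=> y _; rewrite (dist_mem Sv) add0e lee_fin.
apply: dist_ge => // s Ss.
have h : 2 * ip (p - v) (s - v) <= `|s - v| ^+ 2.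
  have : `|p - v| ^+ 2 <= `|(p - v) - (s - v)| ^+ 2.
    by rewrite opprB addrA subrK ler_sqr ?nnegrE ?normr_ge0 // pv.
  rewrite [leRHS](sqr_normB ip_norm); lra.
have hy : ip (t *: (p - v)) (y - v) <= `|y - v|.
  by apply: le_trans (ler_ip ip_norm _ _) _; rewrite ler_piMl.
(* Points of [S] farther from [y] than [v] satisfy the bound for free; the
   others are within [2 |y - v|] of [v], where [h] applies. *)
have [far|close] := lerP `|y - v| `|y - s|.
  by rewrite (le_trans _ far) // (le_trans _ hy) // gerBl !mulr_ge0.
have -> : ip (t *: (p - v)) (y - v) =
    ip (t *: (p - v)) (y - s) + t * ip (p - v) (s - v).
  by rewrite -(ipZl ip) -(ipDr ip) addrA subrK.
have h1 : ip (t *: (p - v)) (y - s) <= `|y - s|.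
  by apply: le_trans (ler_ip ip_norm _ _) _; rewrite ler_piMl.
have h2 : `|s - v| ^+ 2 <= (2 * `|y - v|) ^+ 2.
  rewrite ler_sqr ?nnegrE ?mulr_ge0 //.
  have -> : s - v = (s - y) + (y - v) by rewrite addrA subrK.
  by apply: le_trans (ler_normD _ _) _; rewrite (distrC s); lra.
have h3 : t * (2 * ip (p - v) (s - v)) <= t * (2 * `|y - v|) ^+ 2.
  by rewrite ler_wpM2l // (le_trans h).
have := mulr_ge0 t0 (exprn_ge0 2 (normr_ge0 (y - v))).
move: h1 h3; rewrite exprMn; lra.
Qed.

End NearestPoints.

(* A real Hilbert space is a complete normed space whose norm is induced by the
   inner product [ip]. *)
Theorem lemma1 (R : realType) (H : completeNormedModType R)
    (ip : {dot H for idfun}) (ip_norm : forall u : H, `|u| ^+ 2 = ip u u)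
    (S : set H) (S_neq0 : S !=set0) (S_closed : closed S)
    (x : H) (eps : R) (eps_gt0 : 0 < eps) :
  forall z : H, eps_proj S eps x z ->
  exists v : H, [/\ eps_proj S eps x v,
    `|z - v| < 2 * Num.sqrt eps &
    [set p + b | p in [set (4 * Num.sqrt eps + dist S x) *: zeta
                         | zeta in prox_subdiff ip (fun y => (dist S y)%:E) v]
               & b in [set (3 * Num.sqrt eps) *: u
                         | u in closed_ball (0 : H) 1]] (x - z)].
Proof.
move=> z [Sz xz]; set d := dist S x in xz *; set r := Num.sqrt eps.
have r0 : 0 < r by rewrite sqrtr_gt0.
have r2 : r ^+ 2 = eps by rewrite sqr_sqrtr // ltW.
have d0 : 0 <= d by apply: dist_ge => // *; apply: normr_ge0.
pose gap := d ^+ 2 + eps - `|x - z| ^+ 2.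
have gap0 : 0 < gap by rewrite subr_gt0.
(* [r / 6] serves the final bound [2 * |c + e| <= 2 * r + 6 * delta <= 3 * r]; the other two terms
   give [4 * delta ^+ 2 < gap]. *)
pose delta := Num.min (r / 6) (Num.min 1 (gap / 8)).
have delta0 : 0 < delta by rewrite !lt_min ltr01 !divr_gt0.
have delta_r : delta <= r / 6 by rewrite ge_min lexx.
have delta_gap : 4 * delta ^+ 2 < gap.
  have : delta <= 1 by rewrite !ge_min lexx orbT.
  have : delta <= gap / 8 by rewrite !ge_min lexx !orbT.
  nra.
have [p [v [vnear he]]] :=
  nearest_dense ip_norm S_neq0 (2^-1 *: (x + z)) S_closed delta0.
have [Sv pv] := vnear.
set e := p - _ in he; pose a := x - v; pose c := z - v.
have xzE : x - z = a - c by rewrite /a /c opprB addrA subrK.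
have halfDD (u : H) : 2^-1 *: (u + u) = u.
  by rewrite -mulr2n -(scaler_nat 2 u) scalerA mulVf ?scale1r ?pnatr_eq0.
have pvE : p - v = e + 2^-1 *: (a + c).
  by rewrite /e /a /c addrACA -opprD scalerBr addrA subrK halfDD.
have pzE : p - z = e + 2^-1 *: (a - c).
  have -> : p - z = p - v - c by rewrite /c opprB addrA subrK.
  by rewrite pvE -addrA -{2}(halfDD c) -scalerBr opprD addrA addrK.
have dist_a : d <= `|a| by apply: dist_le.
(* The parallelogram law, perturbed by [e]. *)
have key : `|a| ^+ 2 + `|c| ^+ 2 <= `|x - z| ^+ 2 + 4 * (delta * `|c|).
  have hsq : `|p - v| ^+ 2 <= `|p - z| ^+ 2.
    by rewrite ler_sqr ?nnegrE ?normr_ge0 // pv.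
  have hec : - ip e c <= delta * `|c|.
    rewrite -(ipNl ip); apply: le_trans (ler_ip ip_norm _ _) _.
    by rewrite normrN ler_wpM2r.
  clearbody a c e; move: hsq; rewrite pvE pzE xzE !ip_norm !(ipE ip).
  rewrite (ipC ip c a) (ipC ip a e) (ipC ip c e); lra.
have c0 := normr_ge0 c; have a0 := normr_ge0 a.
(* Completing the square in [key] gives [|a|^2 + (|c| - 2 * delta)^2 < d^2 + eps]. Dropping the
   second square bounds [a]; using [d <= |a|] bounds [c]. *)
have a_lt : `|a| ^+ 2 < d ^+ 2 + eps.
  have := sqr_ge0 (`|c| - 2 * delta); move: key delta_gap; rewrite /gap; nra.
have c_le : `|c| < r + 2 * delta.
  have : (`|c| - 2 * delta) ^+ 2 < r ^+ 2.
    rewrite r2; move: key delta_gap; rewrite /gap; nra.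
  nra.
have a_le : `|a| < d + r by nra.
have pv_le : `|2 *: (p - v)| <= 4 * r + d.
  rewrite pvE scalerDr scalerA mulfV ?pnatr_eq0 // scale1r.
  apply: le_trans (ler_normD _ _) _; rewrite normrZ ger0_norm //.
  have := ler_normD a c; lra.
have K0 : 0 < 4 * r + d by lra.
exists v; split=> //; first by lra.
(* Since [2 (p - v) = a + c + 2 e] and [x - z = a - c], the remainder for the ball is
   [- 2 (c + e)]. *)
exists (2 *: (p - v)).
  exists ((2 / (4 * r + d)) *: (p - v)).
    apply: nearest_prox_subdiff => //; first by rewrite divr_ge0 // ltW.
    rewrite [_ / _]mulrC -scalerA normrZ ger0_norm ?invr_ge0 ?(ltW K0) //.
    by rewrite [leLHS]mulrC ler_pdivrMr // mul1r.
  by rewrite scalerA mulrC divfK // gt_eqF.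
exists (x - z - 2 *: (p - v)); last by rewrite addrC subrK.
exists ((3 * r)^-1 *: (x - z - 2 *: (p - v))).
  rewrite closed_ballE // /closed_ball_ /= sub0r normrN normrZ.
  rewrite ger0_norm ?invr_ge0; last by lra.
  rewrite [leLHS]mulrC ler_pdivrMr ?mul1r; last by lra.
  have -> : x - z - 2 *: (p - v) = - (2 *: (c + e)).
    rewrite xzE pvE scalerDr scalerA mulfV ?pnatr_eq0 // scale1r.
    clearbody a c e; rewrite opprD [- _ - _]addrC addrA [- (a + c)]opprD.
    by rewrite addrACA subrr add0r -!opprD -mulr2n -(scaler_nat 2 c) -scalerDr.
  rewrite normrN normrZ ger0_norm //; have := ler_normD c e; lra.
by rewrite scalerA mulfV ?scale1r // gt_eqF //; lra.
Qed.
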